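(* There exist absolute constants $c>0$ and $c_0\ge 1$ such that for every fast-memory size $M\ge 1$ and every power of two $n\ge c_0\sqrt{M}$, every implementation of Strassen's algorithm on two $n\times n$ matrices in the sequential two-level memory model with fast memory of size $M$, in which no intermediate value is computed twice, moves at least $$c\left(\frac{n}{\sqrt{M}}\right)^{\log_2 7}\cdot M$$ words between slow and fast memory. That is, $IO(n)=\Omega\big((n/\sqrt M)^{\log_2 7} M\big)$. The same holds for Winograd's variant of Strassen's algorithm (which uses 15 rather than 18 block additions per recursion step).
   Context: Strassen's algorithm, for $n\times n$ matrices $A,B$ with $n$ a power of two: if $n=1$, return $C_{11}=A_{11}B_{11}$. Otherwise, split $A,B$ into four $\frac n2\times\frac n2$ blocks and compute $M_1=(A_{11}+A_{22})(B_{11}+B_{22})$, $M_2=(A_{21}+A_{22})B_{11}$, $M_3=A_{11}(B_{12}-B_{22})$, $M_4=A_{22}(B_{21}-B_{11})$, $M_5=(A_{11}+A_{12})B_{22}$, $M_6=(A_{21}-A_{11})(B_{11}+B_{12})$, $M_7=(A_{12}-A_{22})(B_{21}+B_{22})$. The seven block products are computed recursively, and $C_{11}=M_1+M_4-M_5+M_7$, $C_{12}=M_3+M_5$, $C_{21}=M_2+M_4$, $C_{22}=M_1-M_2+M_3+M_6$. All block additions and subtractions are performed entrywise by binary scalar operations. Computation graph (CDAG): a directed acyclic graph with one vertex per input entry and one vertex per scalar arithmetic operation. There is an edge $(u,v)$ whenever the value of $u$ is an operand of the operation $v$. Sequential two-level memory model: - There is a fast memory holding at most $M$ words and an unbounded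 slow memory. - The input matrices initially reside in slow memory, and the outputs must end in slow memory. - A scalar arithmetic operation may be performed only when its operands are in fast memory, and its result is placed in fast memory. - Each word moved from slow to fast memory (read) or from fast to slow memory (write) counts as one unit of communication. An implementation is a schedule of reads, writes and arithmetic operations that computes every vertex of the CDAG exactly once (no recomputation), in an order consistent with the edges. $IO(n)$ denotes the minimum, over all such implementations, of the number of words moved. *)

(* Defs.v *)
From Stdlib Require Import Reals List Arith Bool.
Import ListNotations.
Open Scope bool_scope.

(* Vertices are natural numbers. Vertices 0 .. ninputs-1 are the input  *)
(* entries; vertex ninputs + j is the j-th scalar binary operation,     *)
(* given as (kind, operand1, operand2): edges operand -> vertex.        *)
Inductive opkind := OAdd | OSub | OMul.

Record cdag := mkCdag {
  ninputs : nat;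
  ops : list (opkind * nat * nat);
  outputs : list nat
}.

Definition op_of (g : cdag) (v : nat) : option (opkind * nat * nat) :=
  if ninputs g <=? v then nth_error (ops g) (v - ninputs g) else None.

(* Builder state: (next fresh vertex id, operations in reverse order).  *)
(* Matrices are lists of rows of vertex ids.                            *)
Definition bst := (nat * list (opkind * nat * nat))%type.

Definition newop (k : opkind) (a b : nat) (s : bst) : nat * bst :=
  (fst s, (S (fst s), (k, a, b) :: snd s)).

Definition mat := list (list nat).

Fixpoint row_op (k : opkind) (r1 r2 : list nat) (s : bst) : list nat * bst :=
  match r1, r2 with
  | a :: r1', b :: r2' =>
      let (v, s1) := newop k a b s in
      let (r, s2) := row_op k r1' r2' s1 in (v :: r, s2)
  | _, _ => ([], s)
  end.

Fixpoint mat_op (k : opkind) (X Y : mat) (s : bst) : mat * bst :=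
  match X, Y with
  | r1 :: X', r2 :: Y' =>
      let (r, s1) := row_op k r1 r2 s in
      let (Z, s2) := mat_op k X' Y' s1 in (r :: Z, s2)
  | _, _ => ([], s)
  end.

Definition madd := mat_op OAdd.
Definition msub := mat_op OSub.

Definition blk11 (h : nat) (X : mat) : mat := map (firstn h) (firstn h X).
Definition blk12 (h : nat) (X : mat) : mat := map (skipn h) (firstn h X).
Definition blk21 (h : nat) (X : mat) : mat := map (firstn h) (skipn h X).
Definition blk22 (h : nat) (X : mat) : mat := map (skipn h) (skipn h X).

Definition assemble (C11 C12 C21 C22 : mat) : mat :=
  map (fun p => fst p ++ snd p) (combine C11 C12) ++
  map (fun p => fst p ++ snd p) (combine C21 C22).

Definition entry00 (X : mat) : nat := nth 0 (nth 0 X []) 0.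

(* Strassen's algorithm on 2^k x 2^k matrices.  Multi-term sums are
   evaluated left to right, e.g. C11 = ((M1 + M4) - M5) + M7. *)
Fixpoint strassen (k : nat) (A B : mat) (s : bst) : mat * bst :=
  match k with
  | O => let (v, s1) := newop OMul (entry00 A) (entry00 B) s in ([[v]], s1)
  | S k' =>
    let h := 2 ^ k' in
    let A11 := blk11 h A in let A12 := blk12 h A in
    let A21 := blk21 h A in let A22 := blk22 h A in
    let B11 := blk11 h B in let B12 := blk12 h B in
    let B21 := blk21 h B in let B22 := blk22 h B in
    let (X1, s) := madd A11 A22 s in
    let (Y1, s) := madd B11 B22 s in
    let (M1, s) := strassen k' X1 Y1 s in
    let (X2, s) := madd A21 A22 s in
    let (M2, s) := strassen k' X2 B11 s in
    let (Y3, s) := msub B12 B22 s in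
    let (M3, s) := strassen k' A11 Y3 s in
    let (Y4, s) := msub B21 B11 s in
    let (M4, s) := strassen k' A22 Y4 s in
    let (X5, s) := madd A11 A12 s in
    let (M5, s) := strassen k' X5 B22 s in
    let (X6, s) := msub A21 A11 s in
    let (Y6, s) := madd B11 B12 s in
    let (M6, s) := strassen k' X6 Y6 s in
    let (X7, s) := msub A12 A22 s in
    let (Y7, s) := madd B21 B22 s in
    let (M7, s) := strassen k' X7 Y7 s in
    let (P, s) := madd M1 M4 s in
    let (P, s) := msub P M5 s in
    let (C11, s) := madd P M7 s in
    let (C12, s) := madd M3 M5 s in
    let (C21, s) := madd M2 M4 s in
    let (Q, s) := msub M1 M2 s in
    let (Q, s) := madd Q M3 s in
    let (C22, s) := madd Q M6 s in
    (assemble C11 C12 C21 C22, s)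
  end.

Fixpoint winograd (k : nat) (A B : mat) (s : bst) : mat * bst :=
  match k with
  | O => let (v, s1) := newop OMul (entry00 A) (entry00 B) s in ([[v]], s1)
  | S k' =>
    let h := 2 ^ k' in
    let A11 := blk11 h A in let A12 := blk12 h A in
    let A21 := blk21 h A in let A22 := blk22 h A in
    let B11 := blk11 h B in let B12 := blk12 h B in
    let B21 := blk21 h B in let B22 := blk22 h B in
    let (S1, s) := madd A21 A22 s in
    let (S2, s) := msub S1 A11 s in
    let (S3, s) := msub A11 A21 s in
    let (S4, s) := msub A12 S2 s in
    let (T1, s) := msub B12 B11 s in
    let (T2, s) := msub B22 T1 s in
    let (T3, s) := msub B22 B12 s in
    let (T4, s) := msub T2 B21 s in
    let (M1, s) := winograd k' A11 B11 s in
    let (M2, s) := winograd k' A12 B21 s in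
    let (M3, s) := winograd k' S4 B22 s in
    let (M4, s) := winograd k' A22 T4 s in
    let (M5, s) := winograd k' S1 T1 s in
    let (M6, s) := winograd k' S2 T2 s in
    let (M7, s) := winograd k' S3 T3 s in
    let (U1, s) := madd M1 M2 s in
    let (U2, s) := madd M1 M6 s in
    let (U3, s) := madd U2 M7 s in
    let (U4, s) := madd U2 M5 s in
    let (U5, s) := madd U4 M3 s in
    let (U6, s) := msub U3 M4 s in
    let (U7, s) := madd U3 M5 s in
    (assemble U1 U5 U6 U7, s)
  end.

(* Input matrices for n = 2^k: A(i,j) is vertex i*n+j, B(i,j) is n*n+i*n+j. *)
Definition input_mat (n off : nat) : mat :=
  map (fun i => map (fun j => off + i * n + j) (seq 0 n)) (seq 0 n).

Definition alg_cdag
  (alg : nat -> mat -> mat -> bst -> mat * bst) (k : nat) : cdag :=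
  let n := 2 ^ k in
  let (C, s) := alg k (input_mat n 0) (input_mat n (n * n)) (2 * (n * n), []) in
  mkCdag (2 * (n * n)) (rev (snd s)) (concat C).

Definition strassen_cdag (k : nat) : cdag := alg_cdag strassen k.
Definition winograd_cdag (k : nat) : cdag := alg_cdag winograd k.

Inductive action :=
  | Read (v : nat)
  | Write (v : nat)
  | Compute (v : nat)
  | Discard (v : nat).

Definition mem (v : nat) (l : list nat) : bool := existsb (Nat.eqb v) l.
Definition add (v : nat) (l : list nat) : list nat := if mem v l then l else v :: l.
Definition del (v : nat) (l : list nat) : list nat := filter (fun x => negb (Nat.eqb v x)) l.

Record mstate := mkState {
  fast : list nat;     (* values currently in fast memory (no duplicates) *)
  slow : list nat;
  computed : list nat
}.

Definition init_state (g : cdag) : mstate :=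
  mkState [] (seq 0 (ninputs g)) [].

Definition step (g : cdag) (M : nat) (s : mstate) (a : action) : option mstate :=
  match a with
  | Read v =>
      if mem v (slow s) && (length (add v (fast s)) <=? M)
      then Some (mkState (add v (fast s)) (slow s) (computed s)) else None
  | Write v =>
      if mem v (fast s)
      then Some (mkState (fast s) (add v (slow s)) (computed s)) else None
  | Compute v =>
      match op_of g v with
      | Some (_, a, b) =>
          if mem a (fast s) && mem b (fast s) && negb (mem v (computed s))
             && (length (add v (fast s)) <=? M)
          then Some (mkState (add v (fast s)) (slow s) (v :: computed s))
          else None
      | None => None
      end
  | Discard v => Some (mkState (del v (fast s)) (slow s) (computed s))
  end.

Fixpoint run (g : cdag) (M : nat) (s : mstate) (l : list action) : option mstate :=
  match l with
  | [] => Some s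
  | a :: l' => match step g M s a with Some s' => run g M s' l' | None => None end
  end.

(* An implementation: a legal schedule that computes every operation vertex
   (exactly once: recomputation is rejected by [step]) and leaves all
   outputs in slow memory. *)
Definition implementation (g : cdag) (M : nat) (sched : list action) : Prop :=
  exists s, run g M (init_state g) sched = Some s /\
    (forall v, In v (outputs g) -> In v (slow s)) /\
    (forall j, j < length (ops g) -> In (ninputs g + j) (computed s)).

Definition is_comm (a : action) : bool :=
  match a with Read _ | Write _ => true | _ => false end.

Definition io_cost (sched : list action) : nat := length (filter is_comm sched).

Definition log2_7 : R := (ln 7 / ln 2)%R.

Definition comm_lower_bound (alg_cdag : nat -> cdag) : Prop :=
  exists c c0 : R, (0 < c)%R /\ (1 <= c0)%R /\
    forall (M k : nat), (1 <= M)%nat ->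
      (c0 * sqrt (INR M) <= INR (2 ^ k))%R ->
      forall sched, implementation (alg_cdag k) M sched ->
        (c * Rpower (INR (2 ^ k) / sqrt (INR M)) log2_7 * INR M
          <= INR (io_cost sched))%R.

(* Main.v *)
(** No value is recomputed, so a segment of a schedule that computes the vertex set [S] communicates
    with the rest of the schedule through every vertex lying on an edge between [S] and its
    complement: such an operand is in fast memory at the start or at the end of the segment, or it is
    moved during it.  It therefore suffices to show that a set [S] containing [s] outputs of the
    [7 ^ j] subproblems of size [2 ^ m], and at most half of the outputs of each, has at least
    [s / 16] such operands.  For this, let [X] and [Y] count the outputs of a subproblem inside and
    outside [S], and [I] the operands on the cut among its non-output vertices.  Induction on [m] gives
    [X * Y <= 8 * 4 ^ m * I]: each of the four output blocks is adjacent to its own product block, the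
    one-level decoding graph is connected, and hence at every entry position without a cut operand
    the four output entries and the four product entries lie on the same side.  Segments with
    [4 ^ m / 2] subproblem outputs, where [96 * M <= 4 ^ m < 384 * M], then cost [M] moves each. *)

Require Import Defs.
From Stdlib Require Import Reals List Arith.
From Stdlib Require Import Bool Lia Lra Permutation.
Import ListNotations.

(** * Counting list entries and vertices that satisfy a predicate *)

Definition cnt (p : nat -> bool) (l : list nat) : nat := length (filter p l).

(** Vertex ids are handed out consecutively, so the increase of [cum p] from [fst s] to [fst s']
    counts the vertices satisfying [p] that were created between the builder states [s] and [s']. *)
Definition cum (p : nat -> bool) (n : nat) : nat := cnt p (seq 0 n).

Definition compl (p : nat -> bool) (x : nat) : bool := negb (p x).

Definition sum_over {T : Type} (F : T -> nat) (l : list T) : nat := list_sum (map F l).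

Lemma cnt_cons p x l : cnt p (x :: l) = (if p x then 1 else 0) + cnt p l.
Proof. unfold cnt; simpl; destruct (p x); reflexivity. Qed.

Lemma cnt_app p l1 l2 : cnt p (l1 ++ l2) = cnt p l1 + cnt p l2.
Proof. unfold cnt; now rewrite filter_app, length_app. Qed.

Lemma cnt_perm p l1 l2 : Permutation l1 l2 -> cnt p l1 = cnt p l2.
Proof. induction 1; rewrite ?cnt_cons; lia. Qed.

Lemma cnt_compl p l : cnt p l + cnt (compl p) l = length l.
Proof.
  induction l as [|x l IH]; [reflexivity|].
  rewrite !cnt_cons; unfold compl at 1; simpl; destruct (p x); simpl; lia.
Qed.

Lemma cnt_le_length p l : cnt p l <= length l.
Proof. pose proof (cnt_compl p l); lia. Qed.

Lemma cnt_map p (g : nat -> nat) l : cnt p (map g l) = cnt (fun e => p (g e)) l.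
Proof. induction l as [|x l IH]; [reflexivity|]. simpl map; rewrite !cnt_cons; lia. Qed.

Lemma cnt_le_union p q r l :
  (forall x, In x l -> p x = true -> q x = true \/ r x = true) ->
  cnt p l <= cnt q l + cnt r l.
Proof.
  induction l as [|x l IH]; intros H; [reflexivity|].
  rewrite !cnt_cons.
  pose proof (H x (or_introl eq_refl)).
  assert (cnt p l <= cnt q l + cnt r l) by (apply IH; intros; apply H; [right|]; assumption).
  destruct (p x), (q x), (r x); try lia.
Qed.

Lemma cnt_const_false l : cnt (fun _ => false) l = 0.
Proof. induction l; [reflexivity|]. now rewrite cnt_cons. Qed.

Lemma cnt_pos p x l : In x l -> p x = true -> 1 <= cnt p l.
Proof.
  induction l as [|y l IH]; intros Hin Hp; [contradiction|].
  rewrite cnt_cons; destruct Hin as [->|Hin]; [rewrite Hp; lia|].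
  specialize (IH Hin Hp); lia.
Qed.

Lemma cnt_concat p ls : cnt p (concat ls) = sum_over (cnt p) ls.
Proof.
  induction ls as [|l ls IH]; [reflexivity|].
  cbn [concat]; rewrite cnt_app, IH; reflexivity.
Qed.

Lemma length_concat_const {T} (ls : list (list T)) n :
  (forall l, In l ls -> length l = n) -> length (concat ls) = length ls * n.
Proof.
  induction ls as [|l ls IH]; intros H; [reflexivity|].
  cbn [concat]; rewrite length_app, IH, (H l (or_introl eq_refl)); [reflexivity|].
  intros; apply H; now right.
Qed.

Lemma cnt_mem_NoDup (l B : list nat) :
  NoDup l -> cnt (fun x => mem x B) l <= length B.
Proof.
  intros Hl; unfold cnt; apply NoDup_incl_length.
  - now apply NoDup_filter.
  - intros x Hx; apply filter_In in Hx as [_ Hx].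
    unfold mem in Hx; apply existsb_exists in Hx as (y & Hy & E).
    apply Nat.eqb_eq in E; now subst.
Qed.

Lemma cum_seq p a n : cnt p (seq a n) + cum p a = cum p (a + n).
Proof. unfold cum; rewrite seq_app, cnt_app; apply Nat.add_comm. Qed.

(** Marking a single vertex turns the counting bounds into statements on disjointness and on the
    range of ids. *)
Lemma cum_eqb u n : cum (Nat.eqb u) n = if u <? n then 1 else 0.
Proof.
  induction n as [|n IH]; [reflexivity|].
  unfold cum in *; rewrite seq_S, cnt_app, IH, cnt_cons; cbn [Nat.add cnt filter length].
  destruct (Nat.eqb_spec u n), (Nat.ltb_spec u n), (Nat.ltb_spec u (S n)); cbn; lia.
Qed.

Lemma sum_over_app {T} (F : T -> nat) l1 l2 :
  sum_over F (l1 ++ l2) = sum_over F l1 + sum_over F l2.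
Proof. unfold sum_over; now rewrite map_app, list_sum_app. Qed.

Lemma map_nth_seq (l : list nat) : map (fun e => nth e l 0) (seq 0 (length l)) = l.
Proof.
  apply (nth_ext _ _ 0 0); rewrite length_map, length_seq; [reflexivity|].
  intros n Hn. rewrite (nth_indep _ 0 (nth 0 l 0)) by now rewrite length_map, length_seq.
  rewrite (map_nth (fun e => nth e l 0)), seq_nth by assumption; reflexivity.
Qed.

Lemma cnt_index p l : cnt p l = cnt (fun e => p (nth e l 0)) (seq 0 (length l)).
Proof.
  rewrite <- (cnt_map p (fun e => nth e l 0)); now rewrite map_nth_seq.
Qed.

(** * Expansion of one decoding level *)

(** A marked entry of a list spoils only its own index, so a union bound applies. *)
Lemma bad_index_count (b : nat -> bool) (fam : list (list nat)) D :
  (forall L, In L fam -> length L = D) ->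
  cnt (fun e => existsb (fun L => b (nth e L 0)) fam) (seq 0 D)
    <= sum_over (cnt b) fam.
Proof.
  induction fam as [|L fam IH]; intros HD.
  - cbn [existsb]; now rewrite cnt_const_false.
  - unfold sum_over in *; simpl.
    rewrite (cnt_index b L), (HD L (or_introl eq_refl)).
    etransitivity; [|apply Nat.add_le_mono_l, IH; intros; apply HD; now right].
    apply cnt_le_union; intros e _ He; now apply orb_true_iff in He.
Qed.

(** For the [i]-th output block, [xi] and [yi] count entries inside and outside the vertex set, [ui]
    and [wi] do so for its matched product, and [beta] counts the spoiled indices. Since
    [u + w = D], the product [(u + beta) * (4 * w + 4 * beta)] is [4 * u * w + 4 * D * beta + 4 *
    beta * beta], and [beta <= D] absorbs the square. *)
Lemma product_bound D beta x1 x2 x3 x4 y1 y2 y3 y4 u1 u2 u3 u4 w1 w2 w3 w4 :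
  beta <= D ->
  u1 + w1 = D -> u2 + w2 = D -> u3 + w3 = D -> u4 + w4 = D ->
  x1 <= u1 + beta -> x2 <= u2 + beta -> x3 <= u3 + beta -> x4 <= u4 + beta ->
  y1 + y2 + y3 + y4 <= 4 * w1 + 4 * beta ->
  y1 + y2 + y3 + y4 <= 4 * w2 + 4 * beta ->
  y1 + y2 + y3 + y4 <= 4 * w3 + 4 * beta ->
  y1 + y2 + y3 + y4 <= 4 * w4 + 4 * beta ->
  (x1 + x2 + x3 + x4) * (y1 + y2 + y3 + y4)
    <= 4 * (u1 * w1 + u2 * w2 + u3 * w3 + u4 * w4) + 32 * D * beta.
Proof.
  set (y := y1 + y2 + y3 + y4).
  assert (H : forall x u w, beta <= D -> u + w = D -> x <= u + beta ->
            y <= 4 * w + 4 * beta -> x * y <= 4 * (u * w) + 8 * D * beta).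
  { intros x u w Hb Huw Hx Hy; subst D.
    transitivity ((u + beta) * (4 * w + 4 * beta)); [now apply Nat.mul_le_mono|].
    assert (beta * beta <= (u + w) * beta) by now apply Nat.mul_le_mono_r.
    nia. }
  intros.
  assert (x1 * y <= 4 * (u1 * w1) + 8 * D * beta) by auto.
  assert (x2 * y <= 4 * (u2 * w2) + 8 * D * beta) by auto.
  assert (x3 * y <= 4 * (u3 * w3) + 8 * D * beta) by auto.
  assert (x4 * y <= 4 * (u4 * w4) + 8 * D * beta) by auto.
  lia.
Qed.

(* At an index [e] where no list of [fam] is marked, the four outputs and the four products [n_i]
   agree; so each output block is matched with its own product, up to the marked indices. *)
Lemma decode_level_bound (f b : nat -> bool) D c1 c2 c3 c4 n1 n2 n3 n4 fam :
  let G := [c1; c2; c3; c4; n1; n2; n3; n4] in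
  (forall L, In L G -> length L = D) ->
  (forall L, In L fam -> length L = D) ->
  (forall e, e < D ->
     existsb (fun L => b (nth e L 0)) fam = true \/
     forall L L', In L G -> In L' G -> f (nth e L 0) = f (nth e L' 0)) ->
  (cnt f c1 + cnt f c2 + cnt f c3 + cnt f c4) *
  (cnt (compl f) c1 + cnt (compl f) c2 + cnt (compl f) c3 + cnt (compl f) c4)
  <= 4 * (cnt f n1 * cnt (compl f) n1 + cnt f n2 * cnt (compl f) n2 +
          cnt f n3 * cnt (compl f) n3 + cnt f n4 * cnt (compl f) n4)
     + 32 * D * sum_over (cnt b) fam.
Proof.
  intros G HG Hfam Hgood.
  pose proof (bad_index_count b fam D Hfam) as Hbeta.
  set (bad := fun e => existsb (fun L => b (nth e L 0)) fam) in *.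
  set (beta := cnt bad (seq 0 D)) in *.
  assert (HbD : beta <= D).
  { unfold beta; etransitivity; [apply cnt_le_length|]; now rewrite length_seq. }
  (* Any [g] that factors through [f] is allowed, so the comparison serves [f] and its complement
     alike. *)
  assert (Hcmp : forall g, (forall x y, f x = f y -> g x = g y) -> forall L L',
            In L G -> In L' G -> cnt g L <= cnt g L' + beta).
  { intros g Hg L L' HL HL'.
    rewrite (cnt_index g L), (cnt_index g L'), (HG L HL), (HG L' HL').
    apply cnt_le_union; intros e He Hge; apply in_seq in He.
    destruct (Hgood e) as [Hb|Heq]; [lia|now right|left].
    rewrite <- Hge; apply Hg; auto. }
  assert (Hf : forall L L', In L G -> In L' G -> cnt f L <= cnt f L' + beta)
    by (apply Hcmp; auto).
  assert (Hn : forall L L', In L G -> In L' G ->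
            cnt (compl f) L <= cnt (compl f) L' + beta)
    by (apply Hcmp; unfold compl; intros x y ->; reflexivity).
  etransitivity; [|apply Nat.add_le_mono_l, Nat.mul_le_mono_l, Hbeta].
  assert (Hsum : forall L, In L G ->
    cnt (compl f) c1 + cnt (compl f) c2 + cnt (compl f) c3 + cnt (compl f) c4
      <= 4 * cnt (compl f) L + 4 * beta).
  { intros L HL.
    assert (cnt (compl f) c1 <= cnt (compl f) L + beta) by (apply Hn; simpl; auto 10).
    assert (cnt (compl f) c2 <= cnt (compl f) L + beta) by (apply Hn; simpl; auto 10).
    assert (cnt (compl f) c3 <= cnt (compl f) L + beta) by (apply Hn; simpl; auto 10).
    assert (cnt (compl f) c4 <= cnt (compl f) L + beta) by (apply Hn; simpl; auto 10).
    lia. }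
  apply product_bound; try assumption;
    try (rewrite cnt_compl; apply HG; simpl; auto 10);
    try (apply Hsum; simpl; auto 10);
    apply Hf; simpl; auto 10.
Qed.

(** * The graph builder *)

Definition extends (s s' : bst) : Prop :=
  exists l, snd s' = l ++ snd s /\ fst s' = length l + fst s.

(** The pair [(S v, o :: l)] is the builder state right after the creation of [v], with [l] the
    older operations. Phrased through states, the fact passes to later states by transitivity. *)
Definition has_op (s : bst) (v : nat) (o : opkind * nat * nat) : Prop :=
  exists l, extends (S v, o :: l) s.

Lemma extends_refl s : extends s s.
Proof. now exists []. Qed.

Lemma extends_trans s1 s2 s3 : extends s1 s2 -> extends s2 s3 -> extends s1 s3.
Proof.
  intros (l1 & E1 & F1) (l2 & E2 & F2); exists (l2 ++ l1).
  rewrite E2, E1, app_assoc, length_app; split; [reflexivity|lia].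
Qed.

Lemma has_op_extends s s' v o : has_op s v o -> extends s s' -> has_op s' v o.
Proof. intros (l & H) H'; exists l; eapply extends_trans; eassumption. Qed.

(** [row_op] and [mat_op] silently truncate to the shorter argument; this shape invariant excludes
    that. *)
Definition rect (p n : nat) (X : mat) : Prop :=
  length X = p /\ Forall (fun r => length r = n) X.

Lemma rect_length_concat p n X : rect p n X -> length (concat X) = p * n.
Proof.
  intros [<- H]; apply length_concat_const, Forall_forall, H.
Qed.

Lemma row_op_app k a1 c1 a2 c2 s r1 s1 r2 s2 :
  length a1 = length c1 ->
  row_op k a1 c1 s = (r1, s1) -> row_op k a2 c2 s1 = (r2, s2) ->
  row_op k (a1 ++ a2) (c1 ++ c2) s = (r1 ++ r2, s2).
Proof.
  revert c1 s r1; induction a1 as [|x a1 IH]; intros [|y c1] s r1 Hl H1 H2;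
    try discriminate; simpl in *.
  - now inversion H1; subst.
  - destruct (row_op k a1 c1 _) as [r s'] eqn:E; inversion H1; subst.
    now rewrite (IH c1 _ r (eq_add_S _ _ Hl) E H2).
Qed.

Lemma row_op_spec k a c s r s' :
  length a = length c -> row_op k a c s = (r, s') ->
  extends s s' /\ r = seq (fst s) (length a) /\ fst s' = fst s + length a /\
  forall e, e < length a -> has_op s' (nth e r 0) (k, nth e a 0, nth e c 0).
Proof.
  revert c s r; induction a as [|x a IH]; intros [|y c] s r Hl H;
    try discriminate; simpl in *.
  - inversion H; subst; repeat split; [apply extends_refl|lia|lia].
  - destruct (row_op k a c _) as [r0 s0] eqn:E; inversion H; subst; clear H.
    destruct (IH c _ r0 (eq_add_S _ _ Hl) E) as (Hx & -> & Hs & Ho); simpl in *.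
    split; [|split; [reflexivity|split; [lia|]]].
    + eapply extends_trans; [|exact Hx]; now exists [(k, x, y)].
    + intros [|e] He; [|apply Ho; lia].
      exists (snd s); exact Hx.
Qed.

(** Rows are processed in order with the state threaded through, so a block operation is a single
    row operation on flattened matrices. This allows entry positions to be compared across blocks by
    one index. *)
Lemma mat_op_concat k p n X Y s Z s' :
  rect p n X -> rect p n Y -> mat_op k X Y s = (Z, s') ->
  row_op k (concat X) (concat Y) s = (concat Z, s') /\ rect p n Z.
Proof.
  revert p Y s Z; induction X as [|r1 X IH]; intros p [|r2 Y] s Z [HlX HX] [HlY HY] H;
    simpl in *; subst p; try discriminate.
  - inversion H; subst; repeat split; constructor.
  - destruct (row_op k r1 r2 s) as [r s1] eqn:E1.
    destruct (mat_op k X Y s1) as [Z' s2] eqn:E2; inversion H; subst; clear H.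
    inversion HX; inversion HY; subst.
    destruct (IH (length X) Y s1 Z') as [H HZ]; try (split; auto; fail); auto.
    assert (Hr : length r1 = length r2) by congruence.
    split.
    + simpl; eapply row_op_app; eauto.
    + destruct HZ as [HZ1 HZ2]; split; [simpl; congruence|].
      constructor; [|assumption].
      destruct (row_op_spec _ _ _ _ _ _ Hr E1) as (_ & -> & _); now rewrite length_seq.
Qed.

(** Here [f] is the indicator of a vertex set and [b] a marking: the operand end of every edge
    across the cut is marked. *)
Definition cut_marked (f b : nat -> bool) (s : bst) : Prop :=
  forall v k x y, has_op s v (k, x, y) ->
    (f x = f v \/ b x = true) /\ (f y = f v \/ b y = true).

Lemma cut_marked_extends f b s s' : extends s s' -> cut_marked f b s' -> cut_marked f b s.
Proof. intros H Hc v k x y Hv; apply (Hc v k); eapply has_op_extends; eassumption. Qed.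

(** The factor [K] allows the counting clause to be scaled to the weight [8 * 4 ^ k] of a marked
    vertex before [lia] sees it, since that weight is not a numeral. *)
Lemma mat_op_spec k p n X Y s Z s' :
  mat_op k X Y s = (Z, s') -> rect p n X -> rect p n Y ->
  rect p n Z /\ extends s s' /\
  (forall K b, K * cnt b (concat Z) + K * cum b (fst s) = K * cum b (fst s')) /\
  forall f b, cut_marked f b s' -> forall e, e < p * n ->
    (f (nth e (concat X) 0) = f (nth e (concat Z) 0) \/ b (nth e (concat X) 0) = true) /\
    (f (nth e (concat Y) 0) = f (nth e (concat Z) 0) \/ b (nth e (concat Y) 0) = true).
Proof.
  intros H HX HY; destruct (mat_op_concat _ _ _ _ _ _ _ _ HX HY H) as [Hr HZ].
  pose proof (rect_length_concat _ _ _ HX) as LX.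
  pose proof (rect_length_concat _ _ _ HY) as LY.
  destruct (row_op_spec _ _ _ _ _ _ (eq_trans LX (eq_sym LY)) Hr) as (He & Hs & Hf & Ho).
  split; [assumption|]; split; [assumption|]; split.
  - intros K b; rewrite Hs, Hf, <- Nat.mul_add_distr_l, cum_seq; reflexivity.
  - intros f b Hc e Hlt; apply (Hc _ k), Ho; now rewrite LX.
Qed.

Lemma rect_blocks h X : rect (2 * h) (2 * h) X ->
  rect h h (blk11 h X) /\ rect h h (blk12 h X) /\
  rect h h (blk21 h X) /\ rect h h (blk22 h X).
Proof.
  intros [HX HR]; rewrite Forall_forall in HR.
  assert (Hin : forall g (Y : mat), (forall r, length r = 2 * h -> length (g r) = h) ->
            incl Y X -> Forall (fun r : list nat => length r = h) (map g Y)).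
  { intros g Y Hg HY; apply Forall_forall; intros r Hr.
    apply in_map_iff in Hr as (r0 & <- & Hr0); auto. }
  assert (H1 : incl (firstn h X) X)
    by (intros r Hr; rewrite <- (firstn_skipn h X); apply in_or_app; auto).
  assert (H2 : incl (skipn h X) X)
    by (intros r Hr; rewrite <- (firstn_skipn h X); apply in_or_app; auto).
  unfold blk11, blk12, blk21, blk22.
  repeat split; try (rewrite length_map, ?length_firstn, ?length_skipn; lia);
    apply Hin; auto; intros r Hr; rewrite ?length_firstn, ?length_skipn; lia.
Qed.

(** Joining blocks side by side interleaves their rows; counts of entries are insensitive to
    this. *)
Lemma concat_zip_perm (X Y : mat) : length X = length Y ->
  Permutation (concat (map (fun p => fst p ++ snd p) (combine X Y)))
              (concat X ++ concat Y).
Proof.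
  revert Y; induction X as [|x X IH]; intros [|y Y] H; try discriminate; [constructor|].
  simpl; rewrite <- !app_assoc; apply Permutation_app_head.
  rewrite IH by (simpl in H; lia).
  rewrite !app_assoc; apply Permutation_app_tail, Permutation_app_comm.
Qed.

Lemma rect_zip p n X Y : rect p n X -> rect p n Y ->
  rect p (2 * n) (map (fun q => fst q ++ snd q) (combine X Y)).
Proof.
  intros [HX RX] [HY RY]; split; [rewrite length_map, length_combine; lia|].
  rewrite Forall_forall in *; intros r Hr.
  apply in_map_iff in Hr as ([a c] & <- & Hin).
  pose proof (RX _ (in_combine_l _ _ _ _ Hin)).
  pose proof (RY _ (in_combine_r _ _ _ _ Hin)).
  simpl; rewrite length_app; lia.
Qed.

Lemma rect_assemble h C1 C2 C3 C4 :
  rect h h C1 -> rect h h C2 -> rect h h C3 -> rect h h C4 ->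
  rect (2 * h) (2 * h) (assemble C1 C2 C3 C4).
Proof.
  intros H1 H2 H3 H4; unfold assemble.
  destruct (rect_zip _ _ _ _ H1 H2), (rect_zip _ _ _ _ H3 H4).
  split; [rewrite length_app; lia|now apply Forall_app].
Qed.

Lemma cnt_assemble g h C1 C2 C3 C4 :
  rect h h C1 -> rect h h C2 -> rect h h C3 -> rect h h C4 ->
  cnt g (concat (assemble C1 C2 C3 C4))
    = cnt g (concat C1) + cnt g (concat C2) + cnt g (concat C3) + cnt g (concat C4).
Proof.
  intros [H1 _] [H2 _] [H3 _] [H4 _]; unfold assemble.
  rewrite concat_app, cnt_app.
  rewrite !(cnt_perm g _ _ (concat_zip_perm _ _ (eq_trans H1 (eq_sym H2)))).
  rewrite !(cnt_perm g _ _ (concat_zip_perm _ _ (eq_trans H3 (eq_sym H4)))).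
  rewrite !cnt_app; lia.
Qed.

(** * Expansion of the recursive algorithms *)

Definition algorithm := nat -> mat -> mat -> bst -> mat * bst.

(* The term [cnt b (concat C)] excludes the outputs from the marked vertices that are paid for:
   they are operands only one level up, where they are charged again. *)
Definition expands (alg : algorithm) (k : nat) : Prop :=
  forall A B s C s',
    rect (2 ^ k) (2 ^ k) A -> rect (2 ^ k) (2 ^ k) B -> alg k A B s = (C, s') ->
    rect (2 ^ k) (2 ^ k) C /\ extends s s' /\
    forall f b, cut_marked f b s' ->
      cnt f (concat C) * cnt (compl f) (concat C)
        + 8 * 4 ^ k * cnt b (concat C) + 8 * 4 ^ k * cum b (fst s)
      <= 8 * 4 ^ k * cum b (fst s').

(** Only the order of the recursive calls is kept; the block operations between them are absorbed in
    [extends]. Both algorithms then share the same argument on subproblems. *)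
Inductive calls (alg : algorithm) (k : nat) : nat -> bst -> bst -> Prop :=
| calls_nil s s' : extends s s' -> calls alg k 0 s s'
| calls_cons n s s1 X Y M s2 s' :
    extends s s1 -> rect (2 ^ k) (2 ^ k) X -> rect (2 ^ k) (2 ^ k) Y ->
    alg k X Y s1 = (M, s2) -> calls alg k n s2 s' -> calls alg k (S n) s s'.

Definition makes_seven_calls (alg : algorithm) : Prop :=
  forall k A B s C s',
    rect (2 ^ S k) (2 ^ S k) A -> rect (2 ^ S k) (2 ^ S k) B ->
    alg (S k) A B s = (C, s') -> calls alg k 7 s s'.

(** A single output cannot lie on both sides of the cut, so the product of counts is zero. *)
Lemma expands_base (alg : algorithm) :
  (forall A B s, alg 0 A B s =
     let (v, s1) := newop OMul (entry00 A) (entry00 B) s in ([[v]], s1)) ->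
  expands alg 0.
Proof.
  intros Ha A B s C s' _ _ H; rewrite Ha in H; simpl in H; inversion H; subst; clear H.
  split; [now repeat constructor|split].
  - now exists [(OMul, entry00 A, entry00 B)].
  - intros f b _; cbn [concat app fst].
    pose proof (cum_seq b (fst s) 1) as Hc.
    rewrite Nat.add_1_r in Hc; simpl seq in Hc.
    pose proof (cnt_compl f [fst s]) as Hl; simpl length in Hl.
    simpl Nat.pow; nia.
Qed.

Tactic Notation "peel_op" hyp(H) ident(X) ident(s) :=
  let E := fresh "E" in
  let R := fresh "R" X in let T := fresh "T" X in
  let N := fresh "N" X in let F := fresh "F" X in
  unfold madd, msub in H;
  match type of H with (let (_, _) := ?t in _) = _ => destruct t as [X s] eqn:E end;
  eapply mat_op_spec in E as (R & T & N & F); [|eassumption|eassumption].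

Tactic Notation "peel_call" hyp(H) hyp(IH) ident(X) ident(s) :=
  let E := fresh "E" X in
  let R := fresh "R" X in let T := fresh "T" X in let F := fresh "F" X in
  match type of H with (let (_, _) := ?t in _) = _ => destruct t as [X s] eqn:E end;
  pose proof E as F; eapply IH in F as (R & T & F); [|eassumption|eassumption].

Ltac chain := repeat first [eassumption | apply extends_refl
                           | eapply extends_trans; [eassumption|]].

Ltac mark_back := repeat match goal with
  | T : extends ?s ?s', H : cut_marked ?f ?b ?s' |- _ =>
    lazymatch goal with
    | _ : cut_marked f b s |- _ => fail
    | _ => pose proof (cut_marked_extends _ _ _ _ T H)
    end
  end.

Ltac use_calls f b := repeat match goal with
  | F : forall f0 b0, cut_marked f0 b0 ?s -> _ <= _, H : cut_marked f b ?s |- _ =>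
    specialize (F f b H)
  end.

Ltac use_counts K b := repeat match goal with
  | N : forall K0 b0, K0 * cnt b0 ?Z + _ = _ |- _ => specialize (N K b)
  end.

Ltac use_marks f b e := repeat match goal with
  | F : forall f0 b0, cut_marked f0 b0 ?s -> forall e0, _ -> _ /\ _,
    H : cut_marked f b ?s |- _ => 
      specialize (F f b H e); destruct F; [assumption|]
  end.

Ltac resolve_marks := repeat match goal with
  | F : _ \/ ?b ?x = true, E : ?b ?x = false |- _ =>
      destruct F as [F|F]; [|rewrite E in F; discriminate F]
  end.

Lemma all_equal_to (F : list nat -> bool) (z : bool) (G : list (list nat)) :
  (forall L, In L G -> F L = z) ->
  forall L L', In L G -> In L' G -> F L = F L'.
Proof. intros H L L' HL HL'; now rewrite (H L HL), (H L' HL'). Qed.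

Ltac decode_lengths HD :=
  intros ? Hin; simpl in Hin; repeat (destruct Hin as [<-|Hin]; [now apply HD|]);
  contradiction.

Lemma pow4_square k : 4 ^ k = 2 ^ k * 2 ^ k.
Proof. now rewrite <- Nat.pow_mul_l. Qed.

(** Output block [Ci] is matched with product [Ni], and [fam] lists the blocks that occur as
    operands in the decoding: all seven products and the intermediate sums, but no output. *)
Ltac expansion_step k f b C1 C2 C3 C4 N1 N2 N3 N4 fam :=
  mark_back; use_calls f b;
  let HD := fresh "HD" in let Hdec := fresh "Hdec" in
  pose proof (rect_length_concat (2 ^ k) (2 ^ k)) as HD;
  pose proof (decode_level_bound f b (2 ^ k * 2 ^ k)
    (concat C1) (concat C2) (concat C3) (concat C4)
    (concat N1) (concat N2) (concat N3) (concat N4)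
    (map (@concat nat) fam)) as Hdec;
  cbv zeta in Hdec;
  rewrite !(cnt_assemble _ (2 ^ k)) by assumption;
  unfold sum_over in Hdec; cbn [map list_sum fold_right] in Hdec;
  rewrite Nat.pow_succ_r' in *; rewrite pow4_square in *;
  use_counts (8 * (2 ^ k * 2 ^ k)) b;
  refine (_ (Hdec _ _ _)); clear Hdec;
  (* The charges balance: four times the recursive weight [8 * 4 ^ k] is both the new weight
     [8 * 4 ^ S k] and the coefficient [32 * D] of the decoding bound. *)
  [ lia | decode_lengths HD | decode_lengths HD | ];
  let e := fresh "e" in let He := fresh "He" in let Hb := fresh "Hb" in
  intros e He;
  match goal with |- existsb ?p ?l = true \/ _ => destruct (existsb p l) eqn:Hb end;
  [now left|right];
  cbn [existsb] in Hb; rewrite !orb_false_iff in Hb;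
  use_marks f b e; decompose [and] Hb; resolve_marks;
  (* The decoding graph is connected, so the equalities left along its edges link every block to
     [C1]. *)
  apply (all_equal_to (fun L => f (nth e L 0)) (f (nth e (concat C1) 0)));
  let L := fresh "L" in let HL := fresh "HL" in
  intros L HL; simpl in HL;
  repeat (destruct HL as [<-|HL]; [congruence|]); contradiction.

(** The chain of calls and the induction step for [expands] are proved together, as both are read
    off one unfolding of the algorithm. *)
Lemma strassen_step k : expands strassen k ->
  forall A B s C s',
    rect (2 ^ S k) (2 ^ S k) A -> rect (2 ^ S k) (2 ^ S k) B ->
    strassen (S k) A B s = (C, s') ->
    calls strassen k 7 s s' /\
    rect (2 ^ S k) (2 ^ S k) C /\ extends s s' /\
    forall f b, cut_marked f b s' ->
      cnt f (concat C) * cnt (compl f) (concat C)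
        + 8 * 4 ^ S k * cnt b (concat C) + 8 * 4 ^ S k * cum b (fst s)
      <= 8 * 4 ^ S k * cum b (fst s').
Proof.
  intros IH A B s C s' HA HB H.
  rewrite Nat.pow_succ_r' in HA, HB |- *.
  destruct (rect_blocks _ _ HA) as (RA11 & RA12 & RA21 & RA22).
  destruct (rect_blocks _ _ HB) as (RB11 & RB12 & RB21 & RB22).
  cbn [strassen] in H; cbv zeta in H.
  peel_op H X1 s1. peel_op H Y1 s2. peel_call H IH M1 s3.
  peel_op H X2 s4. peel_call H IH M2 s5.
  peel_op H Y3 s6. peel_call H IH M3 s7.
  peel_op H Y4 s8. peel_call H IH M4 s9.
  peel_op H X5 s10. peel_call H IH M5 s11.
  peel_op H X6 s12. peel_op H Y6 s13. peel_call H IH M6 s14.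
  peel_op H X7 s15. peel_op H Y7 s16. peel_call H IH M7 s17.
  peel_op H P1 s18. peel_op H P2 s19. peel_op H C11 s20.
  peel_op H C12 s21. peel_op H C21 s22.
  peel_op H Q1 s23. peel_op H Q2 s24. peel_op H C22 s25.
  inversion H; subst C s25; clear H.
  split; [|split; [|split]].
  - eapply calls_cons with (s1 := s2); [| | |exact EM1|]; chain.
    eapply calls_cons with (s1 := s4); [| | |exact EM2|]; chain.
    eapply calls_cons with (s1 := s6); [| | |exact EM3|]; chain.
    eapply calls_cons with (s1 := s8); [| | |exact EM4|]; chain.
    eapply calls_cons with (s1 := s10); [| | |exact EM5|]; chain.
    eapply calls_cons with (s1 := s13); [| | |exact EM6|]; chain.
    eapply calls_cons with (s1 := s16); [| | |exact EM7|]; chain.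
    apply calls_nil; chain.
  - now apply rect_assemble.
  - chain.
  - intros f b Hm.
    (* Each output is matched with a direct operand of its last addition. The four products are
       distinct, so each recursive bound is spent once. *)
    expansion_step k f b C11 C12 C21 C22 M7 M3 M2 M6
      [M1; M2; M3; M4; M5; M6; M7; P1; P2; Q1; Q2].
Qed.

Lemma winograd_step k : expands winograd k ->
  forall A B s C s',
    rect (2 ^ S k) (2 ^ S k) A -> rect (2 ^ S k) (2 ^ S k) B ->
    winograd (S k) A B s = (C, s') ->
    calls winograd k 7 s s' /\
    rect (2 ^ S k) (2 ^ S k) C /\ extends s s' /\
    forall f b, cut_marked f b s' ->
      cnt f (concat C) * cnt (compl f) (concat C)
        + 8 * 4 ^ S k * cnt b (concat C) + 8 * 4 ^ S k * cum b (fst s)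
      <= 8 * 4 ^ S k * cum b (fst s').
Proof.
  intros IH A B s C s' HA HB H.
  rewrite Nat.pow_succ_r' in HA, HB |- *.
  destruct (rect_blocks _ _ HA) as (RA11 & RA12 & RA21 & RA22).
  destruct (rect_blocks _ _ HB) as (RB11 & RB12 & RB21 & RB22).
  cbn [winograd] in H; cbv zeta in H.
  peel_op H S1 s1. peel_op H S2 s2. peel_op H S3 s3. peel_op H S4 s4.
  peel_op H T1 s5. peel_op H T2 s6. peel_op H T3 s7. peel_op H T4 s8.
  peel_call H IH M1 s9. peel_call H IH M2 s10. peel_call H IH M3 s11.
  peel_call H IH M4 s12. peel_call H IH M5 s13. peel_call H IH M6 s14.
  peel_call H IH M7 s15.
  peel_op H U1 s16. peel_op H U2 s17. peel_op H U3 s18. peel_op H U4 s19.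
  peel_op H U5 s20. peel_op H U6 s21. peel_op H U7 s22.
  inversion H; subst C s22; clear H.
  split; [|split; [|split]].
  - eapply calls_cons with (s1 := s8); [| | |exact EM1|]; chain.
    eapply calls_cons with (s1 := s9); [| | |exact EM2|]; chain.
    eapply calls_cons with (s1 := s10); [| | |exact EM3|]; chain.
    eapply calls_cons with (s1 := s11); [| | |exact EM4|]; chain.
    eapply calls_cons with (s1 := s12); [| | |exact EM5|]; chain.
    eapply calls_cons with (s1 := s13); [| | |exact EM6|]; chain.
    eapply calls_cons with (s1 := s14); [| | |exact EM7|]; chain.
    apply calls_nil; chain.
  - now apply rect_assemble.
  - chain.
  - intros f b Hm.
    (* The same kind of matching: [U1], [U5], [U6], [U7] have [M2], [M3], [M4], [M5] as last
       operands. *)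
    expansion_step k f b U1 U5 U6 U7 M2 M3 M4 M5
      [M1; M2; M3; M4; M5; M6; M7; U2; U3; U4].
Qed.

Lemma strassen_expands k : expands strassen k.
Proof.
  induction k as [|k IH]; [now apply expands_base|].
  intros A B s C s' HA HB H; now apply (strassen_step k IH A B s C s' HA HB H).
Qed.

Lemma winograd_expands k : expands winograd k.
Proof.
  induction k as [|k IH]; [now apply expands_base|].
  intros A B s C s' HA HB H; now apply (winograd_step k IH A B s C s' HA HB H).
Qed.

Lemma strassen_seven_calls : makes_seven_calls strassen.
Proof.
  intros k A B s C s' HA HB H.
  exact (proj1 (strassen_step k (strassen_expands k) A B s C s' HA HB H)).
Qed.

Lemma winograd_seven_calls : makes_seven_calls winograd.
Proof.
  intros k A B s C s' HA HB H.
  exact (proj1 (winograd_step k (winograd_expands k) A B s C s' HA HB H)).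
Qed.

(** * The disjoint subproblems of a given size *)

Lemma cum_mono b n n' : n <= n' -> cum b n <= cum b n'.
Proof.
  intros H; replace n' with (n + (n' - n)) by lia; rewrite <- cum_seq; lia.
Qed.

Lemma extends_fst s s' : extends s s' -> fst s <= fst s'.
Proof. intros (l & _ & H); lia. Qed.

Definition family_expands (m : nat) (Ls : list (list nat)) (s s' : bst) : Prop :=
  (forall L, In L Ls -> length L = 4 ^ m) /\
  forall f b, cut_marked f b s' ->
    sum_over (fun L => cnt f L * cnt (compl f) L) Ls
      + 8 * 4 ^ m * sum_over (cnt b) Ls + 8 * 4 ^ m * cum b (fst s)
    <= 8 * 4 ^ m * cum b (fst s').

Lemma family_expands_nil m s s' : extends s s' -> family_expands m [] s s'.
Proof.
  intros H; split; [contradiction|]; intros f b _.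
  pose proof (Nat.mul_le_mono_l _ _ (8 * 4 ^ m)
    (cum_mono b _ _ (extends_fst _ _ H))).
  unfold sum_over; simpl map; simpl list_sum; lia.
Qed.

(** The terms in [cum] telescope over consecutive stretches of the construction, so no marked vertex
    is charged twice. *)
Lemma family_expands_app m L1 L2 s1 s2 s3 :
  extends s2 s3 -> family_expands m L1 s1 s2 -> family_expands m L2 s2 s3 ->
  family_expands m (L1 ++ L2) s1 s3.
Proof.
  intros He [A1 H1] [A2 H2]; split.
  - intros L HL; apply in_app_or in HL as [HL|HL]; auto.
  - intros f b Hc; rewrite !sum_over_app.
    specialize (H2 f b Hc); specialize (H1 f b (cut_marked_extends _ _ _ _ He Hc)); lia.
Qed.

Definition subproblems_expand (alg : algorithm) (m j : nat) : Prop :=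
  forall A B s C s',
    rect (2 ^ (j + m)) (2 ^ (j + m)) A -> rect (2 ^ (j + m)) (2 ^ (j + m)) B ->
    alg (j + m) A B s = (C, s') ->
    exists Ls, length Ls = 7 ^ j /\ family_expands m Ls s s'.

Lemma calls_subproblems alg m j n s s' :
  expands alg (j + m) -> subproblems_expand alg m j -> calls alg (j + m) n s s' ->
  extends s s' /\ exists Ls, length Ls = n * 7 ^ j /\ family_expands m Ls s s'.
Proof.
  intros Hx Hs; induction 1 as [s s' He | n s s1 X Y M s2 s' He HX HY Hcall _ [He' IH]].
  - split; [assumption|]; exists []; split; [reflexivity|now apply family_expands_nil].
  - destruct (Hx _ _ _ _ _ HX HY Hcall) as (_ & He2 & _).
    destruct IH as (L2 & E2 & F2).
    destruct (Hs _ _ _ _ _ HX HY Hcall) as (L1 & E1 & F1).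
    split; [eapply extends_trans; [exact He|eapply extends_trans; eassumption]|].
    (* The empty family accounts for the block operations between [s] and [s1]. *)
    exists ([] ++ L1 ++ L2); split; [simpl; rewrite length_app; lia|].
    apply (family_expands_app m _ _ s s1); [eapply extends_trans; eassumption| |].
    + now apply family_expands_nil.
    + now apply (family_expands_app m _ _ s1 s2).
Qed.

Lemma subproblems alg m j :
  (forall k, expands alg k) -> makes_seven_calls alg -> subproblems_expand alg m j.
Proof.
  intros Hx H7; induction j as [|j IH]; intros A B s C s' HA HB H.
  - destruct (Hx _ _ _ _ _ _ HA HB H) as (HC & _ & F).
    exists [concat C]; split; [reflexivity|split].
    + intros L [<-|[]]; rewrite (rect_length_concat _ _ _ HC), pow4_square; reflexivity.
    + intros f b Hc; specialize (F f b Hc).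
      unfold sum_over; cbn [map list_sum fold_right plus] in *; lia.
  - now apply (calls_subproblems alg m j 7 s s' (Hx _) IH), (H7 _ A B s C).
Qed.

Lemma input_mat_rect n off : rect n n (input_mat n off).
Proof.
  unfold input_mat; split; [now rewrite length_map, length_seq|].
  apply Forall_forall; intros r Hr; apply in_map_iff in Hr as (i & <- & _).
  now rewrite length_map, length_seq.
Qed.

(** The counterpart of [cut_marked] for the finished graph. The list [B] may have repetitions and is
    charged by its length. *)
Definition boundary_covered (g : cdag) (f : nat -> bool) (B : list nat) : Prop :=
  forall v k x y, op_of g v = Some (k, x, y) ->
    (f x = f v \/ In x B) /\ (f y = f v \/ In y B).

Lemma mem_In v l : mem v l = true <-> In v l.
Proof.
  unfold mem; rewrite existsb_exists; split.
  - intros (x & Hx & E); apply Nat.eqb_eq in E; now subst.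
  - intros H; exists v; split; [assumption|apply Nat.eqb_refl].
Qed.

Lemma cdag_subproblems alg m j :
  (forall k, expands alg k) -> makes_seven_calls alg ->
  let g := alg_cdag alg (j + m) in
  exists Ls : list (list nat),
    length Ls = 7 ^ j /\ (forall L, In L Ls -> length L = 4 ^ m) /\
    (forall u, cnt (Nat.eqb u) (concat Ls) <= 1) /\
    (forall u, In u (concat Ls) ->
       exists i, u = ninputs g + i /\ i < length (ops g)) /\
    (forall f B, boundary_covered g f B ->
       sum_over (fun L => cnt f L * cnt (compl f) L) Ls <= 8 * 4 ^ m * length B).
Proof.
  intros Hx H7 g; unfold g, alg_cdag; clear g; cbv zeta.
  set (n := 2 ^ (j + m)); set (s0 := (2 * (n * n), [])).
  destruct (alg (j + m) (input_mat n 0) (input_mat n (n * n)) s0) as [C s'] eqn:E.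
  pose proof (input_mat_rect n 0) as HA; pose proof (input_mat_rect n (n * n)) as HB.
  destruct (Hx _ _ _ _ _ _ HA HB E) as (_ & He & _).
  destruct (subproblems alg m j Hx H7 _ _ _ _ _ HA HB E) as (Ls & HLs & Hlen & HF).
  cbn [ninputs ops].
  assert (Hfst : fst s' = length (snd s') + 2 * (n * n)).
  { destruct He as (l & -> & ->); unfold s0; cbn [fst snd]; now rewrite app_nil_r. }
  (* The empty vertex set has no cut, so every marking [b] is admissible. Taking [b] to be the
     indicator of one vertex then shows that the subproblem outputs are distinct operation
     vertices. *)
  assert (Hcount : forall b, sum_over (cnt b) Ls + cum b (2 * (n * n)) <= cum b (fst s')).
  { intros b.
    assert (HK : 0 < 8 * 4 ^ m) by (pose proof (Nat.pow_nonzero 4 m); lia).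
    apply (Nat.mul_le_mono_pos_l _ _ _ HK).
    refine (_ (HF (fun _ => false) b _)); [unfold s0; cbn [fst]; lia|].
    intros v k x y _; auto. }
  exists Ls; split; [assumption|]; split; [assumption|]; split; [|split].
  - intros u; specialize (Hcount (Nat.eqb u)).
    rewrite cnt_concat; rewrite !cum_eqb in Hcount.
    destruct (u <? fst s'); lia.
  - intros u Hu; specialize (Hcount (Nat.eqb u)).
    rewrite <- cnt_concat, !cum_eqb in Hcount.
    pose proof (cnt_pos _ _ _ Hu (Nat.eqb_refl u)).
    destruct (Nat.ltb_spec u (fst s')), (Nat.ltb_spec u (2 * (n * n))); try lia.
    exists (u - 2 * (n * n)); rewrite length_rev; lia.
  - intros f B Hb.
    refine (_ (HF f (fun u => mem u B) _)).
    + intros HF'.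
      assert (Hc : cum (fun u => mem u B) (fst s') <= length B)
        by apply cnt_mem_NoDup, seq_NoDup.
      apply (Nat.mul_le_mono_l _ _ (8 * 4 ^ m)) in Hc; lia.
    + intros v k x y (l & l' & Hsnd & Hv); cbn [fst snd] in Hsnd, Hv.
      cbv beta; rewrite !mem_In; apply (Hb v k).
      unfold op_of; cbn [ninputs ops].
      rewrite Hsnd, length_app in Hfst; cbn [length] in Hfst.
      destruct (Nat.leb_spec (2 * (n * n)) v); [|lia].
      (* The builder keeps operations newest first, so after reversal the index of [v] is the number
         of older operations. *)
      replace (v - 2 * (n * n)) with (length l) by lia.
      rewrite Hsnd, rev_app_distr; cbn [rev]; rewrite <- app_assoc.
      rewrite nth_error_app2, length_rev, Nat.sub_diag by now rewrite length_rev.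
      reflexivity.
Qed.

(** * Schedules *)

Definition moved (l : list action) : list nat :=
  flat_map (fun a => match a with Read v | Write v => [v] | _ => [] end) l.

Lemma io_cost_moved l : io_cost l = length (moved l).
Proof. unfold io_cost; induction l as [|[] l IH]; simpl; congruence. Qed.

Lemma io_cost_app l1 l2 : io_cost (l1 ++ l2) = io_cost l1 + io_cost l2.
Proof. unfold io_cost; now rewrite filter_app, length_app. Qed.

Lemma In_add x v l : In x (add v l) <-> x = v \/ In x l.
Proof.
  unfold add; destruct (mem v l) eqn:E; simpl.
  - apply mem_In in E; split; [auto|intros [->|]; auto].
  - split; intros [|]; auto.
Qed.

Lemma In_del x v l : In x (del v l) -> In x l.
Proof. intros H; now apply filter_In in H. Qed.

Definition is_operand (g : cdag) (z v : nat) : Prop :=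
  exists k x y, op_of g v = Some (k, x, y) /\ (z = x \/ z = y).

Lemma step_inv g M s a s' : step g M s a = Some s' ->
  match a with
  | Read v => In v (slow s) /\ fast s' = add v (fast s) /\ slow s' = slow s /\
      computed s' = computed s /\ length (fast s') <= M
  | Write v => In v (fast s) /\ fast s' = fast s /\ slow s' = add v (slow s) /\
      computed s' = computed s
  | Compute v => op_of g v <> None /\ (forall z, is_operand g z v -> In z (fast s)) /\
      ~ In v (computed s) /\ fast s' = add v (fast s) /\ slow s' = slow s /\
      computed s' = v :: computed s /\ length (fast s') <= M
  | Discard v => fast s' = del v (fast s) /\ slow s' = slow s /\ computed s' = computed s
  end.
Proof.
  destruct a as [v|v|v|v]; simpl; intros H.
  - destruct (mem v (slow s)) eqn:E1; [|discriminate].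
    destruct (Nat.leb_spec (length (add v (fast s))) M); [|discriminate].
    inversion H; subst; simpl; apply mem_In in E1; auto.
  - destruct (mem v (fast s)) eqn:E1; [|discriminate].
    inversion H; subst; simpl; apply mem_In in E1; auto.
  - destruct (op_of g v) as [[[k x] y]|] eqn:E0; [|discriminate].
    destruct (mem x (fast s)) eqn:E1; [|discriminate].
    destruct (mem y (fast s)) eqn:E2; [|discriminate].
    destruct (mem v (computed s)) eqn:E3; [discriminate|].
    destruct (Nat.leb_spec (length (add v (fast s))) M); [|discriminate].
    apply mem_In in E1, E2.
    inversion H; subst; simpl; repeat split; auto; [discriminate| |].
    + intros z (k' & x' & y' & E & Hz); rewrite E0 in E; inversion E; subst.
      now destruct Hz as [->| ->].
    + intros Hin; apply mem_In in Hin; congruence.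
  - inversion H; subst; auto.
Qed.

Lemma step_computed g M s a s' : step g M s a = Some s' ->
  incl (computed s) (computed s').
Proof.
  intros H; apply step_inv in H; destruct a; decompose [and] H; clear H;
    match goal with E : computed s' = _ |- _ => rewrite E end;
    intros x Hx; simpl; auto.
Qed.

Lemma run_computed g M l s s' : run g M s l = Some s' ->
  incl (computed s) (computed s').
Proof.
  revert s; induction l as [|a l IH]; intros s H; simpl in H.
  - inversion H; apply incl_refl.
  - destruct (step g M s a) as [s1|] eqn:E; [|discriminate].
    eapply incl_tran; [eapply step_computed|]; eauto.
Qed.

Lemma step_fast g M s a s' x : step g M s a = Some s' -> In x (fast s') ->
  In x (fast s) \/ In x (moved [a]) \/ (In x (computed s') /\ ~ In x (computed s)).
Proof.
  intros H Hx; apply step_inv in H; destruct a as [v|v|v|v]; decompose [and] H; clear H;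
    match goal with E : fast s' = _ |- _ => rewrite E in Hx end;
    try (apply In_add in Hx; destruct Hx as [->|Hx]); auto.
  - right; left; simpl; auto.
  - right; right; split; [|assumption].
    match goal with E : computed s' = _ |- _ => rewrite E end; simpl; auto.
  - apply In_del in Hx; auto.
Qed.

Lemma run_fast g M l s s' x : run g M s l = Some s' -> In x (fast s') ->
  In x (fast s) \/ In x (moved l) \/ (In x (computed s') /\ ~ In x (computed s)).
Proof.
  revert s; induction l as [|a l IH]; intros s H Hx; simpl in H.
  - inversion H; subst; auto.
  - destruct (step g M s a) as [s1|] eqn:E; [|discriminate].
    change (moved (a :: l)) with (moved ([a] ++ l)).
    unfold moved at 1; rewrite flat_map_app, in_app_iff.
    pose proof (run_computed _ _ _ _ _ H) as I1.
    pose proof (step_computed _ _ _ _ _ E) as I0.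
    destruct (IH s1 H Hx) as [Hf|[Hm|[Hc Hn]]].
    + destruct (step_fast _ _ _ _ _ _ E Hf) as [|[|[Hc Hn]]]; auto.
    + auto.
    + right; right; split; [assumption|]; intros Hs; apply Hn; auto.
Qed.

Lemma run_slow g M l s s' x : run g M s l = Some s' -> In x (slow s') ->
  In x (slow s) \/ In x (moved l).
Proof.
  revert s; induction l as [|a l IH]; intros s H Hx; simpl in H.
  - inversion H; subst; auto.
  - destruct (step g M s a) as [s1|] eqn:E; [|discriminate].
    change (moved (a :: l)) with (moved ([a] ++ l)).
    unfold moved; rewrite flat_map_app, in_app_iff.
    destruct (IH s1 H Hx) as [Hf|Hm]; [|auto].
    apply step_inv in E; destruct a as [v|v|v|v]; decompose [and] E; clear E;
      match goal with E : slow s1 = _ |- _ => rewrite E in Hf end; auto.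
    apply In_add in Hf; destruct Hf as [->|Hf]; [right; left; simpl; auto|auto].
Qed.

(* Without recomputation, a value that has left both memories is lost for good. *)
Lemma run_lost g M l s s' x : run g M s l = Some s' ->
  In x (computed s) -> ~ In x (fast s) -> ~ In x (slow s) -> ~ In x (fast s').
Proof.
  revert s; induction l as [|a l IH]; intros s H Hc Hf Hs; simpl in H.
  - inversion H; now subst.
  - destruct (step g M s a) as [s1|] eqn:E; [|discriminate].
    apply (IH s1 H); [eapply step_computed; eauto| |];
      apply step_inv in E; destruct a as [v|v|v|v]; decompose [and] E; clear E;
      intros Hx;
      match goal with
      | E : fast s1 = _, H : In x (fast s1) |- _ => rewrite E in H
      | E : slow s1 = _, H : In x (slow s1) |- _ => rewrite E in H
      end; try (apply In_add in Hx; destruct Hx as [->|Hx]); auto.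
    apply In_del in Hx; auto.
Qed.

Lemma operand_visit g M l s s' z v : run g M s l = Some s' ->
  In v (computed s') -> ~ In v (computed s) -> is_operand g z v ->
  exists l1 l2 r, l = l1 ++ l2 /\ run g M s l1 = Some r /\ run g M r l2 = Some s' /\
                  In z (fast r).
Proof.
  revert s; induction l as [|a l IH]; intros s H Hv Hn Hz; simpl in H.
  - inversion H; subst; contradiction.
  - destruct (step g M s a) as [s1|] eqn:E; [|discriminate].
    destruct (in_dec Nat.eq_dec v (computed s1)) as [Hv1|Hv1].
    + exists [], (a :: l), s; simpl; rewrite E; repeat split; auto.
      apply step_inv in E; destruct a as [w|w|w|w]; decompose [and] E; clear E;
        match goal with E : computed s1 = _ |- _ => rewrite E in Hv1 end; try contradiction.
      destruct Hv1 as [->|]; [auto|contradiction].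
    + destruct (IH s1 H Hv Hv1 Hz) as (l1 & l2 & r & -> & H1 & H2 & H3).
      exists (a :: l1), l2, r; simpl; rewrite E; auto.
Qed.

(** Invariants of reachable states. Inputs never enter [computed], hence the separate alternative
    [x < ninputs g]. *)
Record coherent (g : cdag) (M : nat) (s : mstate) : Prop := {
  coherent_values : forall x, In x (fast s) \/ In x (slow s) ->
    x < ninputs g \/ In x (computed s);
  coherent_ops : forall v, In v (computed s) -> ninputs g <= v;
  coherent_operands : forall v z, In v (computed s) -> is_operand g z v ->
    z < ninputs g \/ In z (computed s);
  coherent_capacity : length (fast s) <= M
}.

Lemma coherent_init g M : coherent g M (init_state g).
Proof.
  split; simpl; try contradiction; [|lia].
  intros x [[]|H]; apply in_seq in H; lia.
Qed.

Lemma step_coherent g M s a s' : coherent g M s -> step g M s a = Some s' ->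
  coherent g M s'.
Proof.
  intros [H1 H2 H3 H4] E; apply step_inv in E.
  destruct a as [v|v|v|v]; simpl in E.
  - destruct E as (E1 & Ef & Es & Ec & EM).
    split; rewrite ?Ef, ?Es, ?Ec in *; auto.
    intros x [Hx|Hx]; [apply In_add in Hx; destruct Hx as [->|Hx]|]; auto.
  - destruct E as (E1 & Ef & Es & Ec).
    split; rewrite ?Ef, ?Es, ?Ec in *; auto.
    intros x [Hx|Hx]; [|apply In_add in Hx; destruct Hx as [->|Hx]]; auto.
  - destruct E as (E1 & E2 & E3 & Ef & Es & Ec & EM).
    split; rewrite ?Ef, ?Es, ?Ec in *; auto.
    + intros x [Hx|Hx]; [apply In_add in Hx; destruct Hx as [->|Hx]|]; simpl; auto.
      * destruct (H1 x (or_introl Hx)); auto.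
      * destruct (H1 x (or_intror Hx)); auto.
    + intros w [->|Hw]; [|auto].
      unfold op_of in E1; destruct (Nat.leb_spec (ninputs g) w); congruence.
    + intros w z [->|Hw] Hz; simpl.
      * destruct (H1 z (or_introl (E2 z Hz))); auto.
      * destruct (H3 w z Hw Hz); auto.
  - destruct E as (Ef & Es & Ec).
    split; rewrite ?Ef, ?Es, ?Ec in *; auto.
    + intros x [Hx|Hx]; [apply In_del in Hx|]; auto.
    + etransitivity; [apply filter_length_le|assumption].
Qed.

Lemma run_coherent g M l s s' : coherent g M s -> run g M s l = Some s' ->
  coherent g M s'.
Proof.
  revert s; induction l as [|a l IH]; intros s Hs H; simpl in H.
  - inversion H; now subst.
  - destruct (step g M s a) as [s1|] eqn:E; [|discriminate].
    eapply IH; [eapply step_coherent|]; eauto.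
Qed.

(** * Segments of a schedule and their cost *)

Definition new_in (s s1 : mstate) (v : nat) : bool :=
  mem v (computed s1) && negb (mem v (computed s)).

Lemma new_in_iff s s1 v :
  new_in s s1 v = true <-> In v (computed s1) /\ ~ In v (computed s).
Proof.
  unfold new_in; rewrite andb_true_iff, negb_true_iff, mem_In, <- not_true_iff_false, mem_In.
  reflexivity.
Qed.

(** If only [v] is computed in the segment, [z] is in fast memory at that moment without having been
    created in the segment. If only [z] is, then [v] comes later, because operands precede results,
    and [z] has to outlive the segment. *)
Lemma segment_operand g M l1 l2 s s1 s2 v z :
  coherent g M s -> run g M s l1 = Some s1 -> run g M s1 l2 = Some s2 ->
  (forall v, op_of g v <> None -> In v (computed s2)) ->
  is_operand g z v ->
  new_in s s1 z = new_in s s1 v \/ In z (fast s ++ moved l1 ++ fast s1).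
Proof.
  intros Hs R1 R2 Hall Hz; rewrite !in_app_iff.
  destruct (new_in s s1 v) eqn:Ev; destruct (new_in s s1 z) eqn:Ez; auto.
  - right; apply new_in_iff in Ev as [Hv Hv'].
    destruct (operand_visit _ _ _ _ _ _ _ R1 Hv Hv' Hz) as (la & lb & r & -> & Ra & Rb & Hr).
    destruct (run_fast _ _ _ _ _ _ Ra Hr) as [|[|[Hc Hn]]]; [auto| |].
    + unfold moved; rewrite flat_map_app, in_app_iff; auto.
    + apply (run_computed _ _ _ _ _ Rb) in Hc.
      assert (new_in s s1 z = true) by now apply new_in_iff. congruence.
  - right; apply new_in_iff in Ez as [Hz1 Hz0].
    pose proof (run_coherent _ _ _ _ _ Hs R1) as Hs1.
    pose proof (coherent_ops _ _ _ Hs1 z Hz1) as Hge.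
    destruct (in_dec Nat.eq_dec v (computed s)) as [Hv|Hv].
    { destruct (coherent_operands _ _ _ Hs v z Hv Hz); [lia|contradiction]. }
    destruct (in_dec Nat.eq_dec v (computed s1)) as [Hv1|Hv1].
    { assert (new_in s s1 v = true) by now apply new_in_iff. congruence. }
    assert (Hv2 : In v (computed s2)).
    { apply Hall; destruct Hz as (k & x & y & E & _); congruence. }
    destruct (in_dec Nat.eq_dec z (fast s1)) as [|Hf]; [auto|].
    (* A copy in slow memory was written during the segment, as [z] did not exist before; with no
       copy anywhere, [z] is lost before [v] uses it. *)
    destruct (in_dec Nat.eq_dec z (slow s1)) as [Hsl|Hsl].
    + destruct (run_slow _ _ _ _ _ _ R1 Hsl) as [Hsl0|]; [|auto].
      destruct (coherent_values _ _ _ Hs z (or_intror Hsl0)); [lia|contradiction].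
    + destruct (operand_visit _ _ _ _ _ _ _ R2 Hv2 Hv1 Hz) as (la & lb & r & -> & Ra & Rb & Hr).
      exfalso; exact (run_lost _ _ _ _ _ _ Ra Hz1 Hf Hsl Hr).
Qed.

Definition progress (I : list nat) (s : mstate) : nat :=
  cnt (fun v => mem v (computed s)) I.

Lemma progress_new I s s1 : incl (computed s) (computed s1) ->
  cnt (new_in s s1) I + progress I s = progress I s1.
Proof.
  intros H; unfold progress; induction I as [|v I IH]; [reflexivity|].
  rewrite !cnt_cons; unfold new_in at 1.
  pose proof (H v) as Hv; rewrite <- !mem_In in Hv.
  destruct (mem v (computed s)), (mem v (computed s1)); simpl; lia.
Qed.

Lemma step_progress g M I s a s1 : (forall u, cnt (Nat.eqb u) I <= 1) ->
  step g M s a = Some s1 -> progress I s1 <= S (progress I s).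
Proof.
  intros HI H; apply step_inv in H; unfold progress; destruct a as [v|v|v|v];
    decompose [and] H; clear H;
    match goal with E : computed s1 = _ |- _ => rewrite E end; try lia.
  specialize (HI v).
  etransitivity; [apply (cnt_le_union _ (fun u => mem u (computed s)) (Nat.eqb v))|lia].
  intros u _ Hu; apply mem_In in Hu; destruct Hu as [->|Hu].
  - right; apply Nat.eqb_refl.
  - left; now apply mem_In.
Qed.

(** A discrete intermediate value argument: the vertices of [I] are distinct, so each action raises
    the progress by at most one and every level is hit exactly. *)
Lemma run_split g M I h l s t : (forall u, cnt (Nat.eqb u) I <= 1) ->
  run g M s l = Some t -> progress I s + h <= progress I t ->
  exists l1 l2 s1, l = l1 ++ l2 /\ run g M s l1 = Some s1 /\ run g M s1 l2 = Some t /\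
    progress I s1 = progress I s + h.
Proof.
  intros HI; revert s h; induction l as [|a l IH]; intros s h H Hh.
  - simpl in H; inversion H; subst; exists [], [], t; repeat split; lia.
  - destruct h as [|h]; [exists [], (a :: l), s; repeat split; [assumption|lia]|].
    simpl in H; destruct (step g M s a) as [s0|] eqn:E; [|discriminate].
    pose proof (step_progress _ _ _ _ _ _ HI E).
    pose proof (progress_new I _ _ (step_computed _ _ _ _ _ E)).
    destruct (IH s0 (progress I s + S h - progress I s0) H) as (l1 & l2 & s1 & -> & R1 & R2 & Hp);
      [lia|].
    exists (a :: l1), l2, s1; simpl; rewrite E; repeat split; auto; lia.
Qed.

(* The segment computes [h] distinguished vertices in total, hence misses at least half of each list. *)
Lemma segment_cost g M h Ls l1 l2 s s1 s2 :
  (forall L, In L Ls -> length L = 2 * h) ->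
  (forall f B, boundary_covered g f B ->
     sum_over (fun L => cnt f L * cnt (compl f) L) Ls <= 16 * h * length B) ->
  48 * M <= h -> 1 <= M ->
  coherent g M s -> run g M s l1 = Some s1 -> run g M s1 l2 = Some s2 ->
  (forall v, op_of g v <> None -> In v (computed s2)) ->
  cnt (new_in s s1) (concat Ls) = h -> M <= io_cost l1.
Proof.
  intros Hlen Hexp Hh HM Hs R1 R2 Hall Hc; set (f := new_in s s1) in *.
  set (B := fast s ++ moved l1 ++ fast s1).
  assert (HB : boundary_covered g f B).
  { intros v k x y E; split; apply (segment_operand g M l1 l2 s s1 s2); auto;
      exists k, x, y; auto. }
  apply Hexp in HB.
  (* A total of at most [h] forces [cnt f L <= h] for each list, and then at least [h] of its
     [2 * h] entries lie outside. *)
  assert (Hsum : forall Ks, incl Ks Ls -> sum_over (cnt f) Ks <= h ->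
            sum_over (cnt f) Ks * h <= sum_over (fun L => cnt f L * cnt (compl f) L) Ks).
  { unfold sum_over; induction Ks as [|L Ks IH]; intros HI Hle; [simpl; lia|].
    simpl in *.
    pose proof (Hlen L (HI L (or_introl eq_refl))).
    pose proof (cnt_compl f L).
    assert (cnt f L * h <= cnt f L * cnt (compl f) L) by (apply Nat.mul_le_mono_l; lia).
    assert (incl Ks Ls) by (intros x Hx; apply HI; now right).
    specialize (IH H2); lia. }
  specialize (Hsum Ls (incl_refl _)); rewrite <- cnt_concat, Hc in Hsum.
  specialize (Hsum (le_n _)).
  assert (Hb : h <= 16 * length B) by nia.
  (* The two fast memories contribute at most [2 * M] to [B], so
     [48 * M <= h <= 16 * (2 * M + io_cost l1)], which leaves [M] moves. *)
  unfold B in Hb; rewrite !length_app, <- io_cost_moved in Hb.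
  pose proof (coherent_capacity _ _ _ Hs).
  pose proof (coherent_capacity _ _ _ (run_coherent _ _ _ _ _ Hs R1)).
  lia.
Qed.

Lemma segments_cost g M h Ls q l s t :
  (forall L, In L Ls -> length L = 2 * h) ->
  (forall f B, boundary_covered g f B ->
     sum_over (fun L => cnt f L * cnt (compl f) L) Ls <= 16 * h * length B) ->
  48 * M <= h -> 1 <= M ->
  (forall u, cnt (Nat.eqb u) (concat Ls) <= 1) ->
  coherent g M s -> run g M s l = Some t ->
  (forall v, op_of g v <> None -> In v (computed t)) ->
  progress (concat Ls) s + q * h <= progress (concat Ls) t -> q * M <= io_cost l.
Proof.
  intros Hlen Hexp Hh HM HI; revert l s; induction q as [|q IH]; intros l s Hs R Hall Hp; [simpl; lia|].
  destruct (run_split g M (concat Ls) h l s t HI R) as (l1 & l2 & s1 & -> & R1 & R2 & Hp1);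
    [simpl in Hp; lia|].
  pose proof (progress_new (concat Ls) _ _ (run_computed _ _ _ _ _ R1)).
  assert (M <= io_cost l1) by (eapply segment_cost; eauto; lia).
  assert (q * M <= io_cost l2).
  { apply (IH l2 s1); auto; [eapply run_coherent; eauto|simpl in Hp; lia]. }
  rewrite io_cost_app; simpl; lia.
Qed.

Lemma implementation_cost alg m j M sched :
  (forall k, expands alg k) -> makes_seven_calls alg -> 1 <= M -> 96 * M <= 4 ^ m ->
  implementation (alg_cdag alg (j + m)) M sched -> 7 ^ j * M <= io_cost sched.
Proof.
  intros Hx H7 HM Hm (t & R & _ & Hall).
  destruct (cdag_subproblems alg m j Hx H7) as (Ls & HLs & Hlen & HI & Hin & Hexp).
  set (g := alg_cdag alg (j + m)) in *.
  (* The capacity hypothesis excludes [m = 0], so the number of outputs of a subproblem is even and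
     [h] is exactly half of it. *)
  destruct m as [|m]; [simpl in Hm; lia|].
  rewrite Nat.pow_succ_r' in Hlen, Hexp, Hm; set (h := 2 * 4 ^ m).
  assert (Hlen' : forall L, In L Ls -> length L = 2 * h)
    by (intros L HL; rewrite (Hlen L HL); unfold h; lia).
  assert (Hcomp : forall v, op_of g v <> None -> In v (computed t)).
  { intros v Hv; unfold op_of in Hv.
    destruct (Nat.leb_spec (ninputs g) v); [|congruence].
    apply nth_error_Some in Hv; specialize (Hall _ Hv).
    now replace (ninputs g + (v - ninputs g)) with v in Hall by lia. }
  apply (segments_cost g M h Ls (7 ^ j) sched (init_state g) t Hlen'); auto.
  - intros f B HB; specialize (Hexp f B HB); unfold h; lia.
  - unfold h; lia.
  - apply coherent_init.
  - assert (Hfull : progress (concat Ls) t = length (concat Ls)).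
    { unfold progress, cnt; f_equal; apply forallb_filter_id, forallb_forall.
      intros u Hu; apply mem_In; destruct (Hin u Hu) as (i & -> & Hi); auto. }
    assert (Htot : length (concat Ls) = length Ls * (2 * h))
      by now apply length_concat_const.
    rewrite Hfull, Htot, HLs; unfold progress; simpl computed.
    rewrite cnt_const_false.
    nia.
Qed.

(** * The asymptotic form *)

Lemma subproblem_size M : 1 <= M -> exists m, 96 * M <= 4 ^ m /\ 4 ^ m < 384 * M.
Proof.
  intros HM.
  assert (H : forall N, 1 <= N -> exists m, 4 ^ m <= N < 4 ^ S m).
  { intros N HN; induction N as [|N IH]; [lia|].
    destruct N as [|N]; [exists 0; simpl; lia|].
    destruct IH as (m & Hm); [lia|].
    destruct (Nat.lt_ge_cases (S (S N)) (4 ^ S m)); [exists m; lia|].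
    exists (S m); split; [assumption|].
    rewrite Nat.pow_succ_r'; pose proof (Nat.pow_nonzero 4 (S m)); lia. }
  (* The largest power of four below [384 * M] is at least a quarter of it. *)
  destruct (H (384 * M - 1)) as (m & Hm); [lia|].
  rewrite Nat.pow_succ_r' in Hm; exists m; lia.
Qed.

Lemma Rpower_log2_7 i : Rpower (2 ^ i) log2_7 = (7 ^ i)%R.
Proof.
  assert (H2 : (0 < ln 2)%R) by (rewrite <- ln_1; apply ln_increasing; lra).
  rewrite <- (Rpower_pow i 2), Rpower_mult by lra.
  rewrite <- (Rpower_pow i 7) by lra.
  unfold Rpower, log2_7; f_equal; field; lra.
Qed.

Lemma lower_bound_of_expansion alg :
  (forall k, expands alg k) -> makes_seven_calls alg -> comm_lower_bound (alg_cdag alg).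
Proof.
  (* The value [20] works because [20 ^ 2 > 384], which gives [m <= k]. From [4 ^ m < 384 * M]
     follows [2 ^ m <= 32 * r] with [r = sqrt M]; as [32 = 2 ^ 5], the ratio [2 ^ k / r] is at most
     [2 ^ (j + 5)], whence the loss of [7 ^ 5]. *)
  intros Hx H7; exists (/ 7 ^ 5)%R, 20%R; split; [|split; [lra|]].
  { apply Rinv_0_lt_compat, pow_lt; lra. }
  intros M k HM Hk sched Himp.
  destruct (subproblem_size M HM) as (m & Hm1 & Hm2).
  set (r := sqrt (INR M)) in *.
  assert (HMR : (1 <= INR M)%R) by (change 1%R with (INR 1); now apply le_INR).
  assert (Hr : (0 < r)%R) by (apply sqrt_lt_R0; lra).
  assert (Hrr : (r * r = INR M)%R) by (apply sqrt_sqrt; lra).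
  assert (H4R : forall i, INR (4 ^ i) = (INR (2 ^ i) * INR (2 ^ i))%R)
    by (intros i; now rewrite pow4_square, mult_INR).
  assert (Hpos : forall i, (0 < INR (2 ^ i))%R)
    by (intros i; rewrite pow_INR; apply pow_lt; simpl; lra).
  assert (Hm2R : (INR (4 ^ m) < 384 * INR M)%R).
  { apply lt_INR in Hm2; rewrite mult_INR in Hm2.
    replace (INR 384) with 384%R in Hm2 by (rewrite INR_IZR_INZ; reflexivity); exact Hm2. }
  assert (Hmk : m <= k).
  { destruct (Nat.le_gt_cases m k) as [|Hlt]; [assumption|exfalso].
    assert (Hle : 4 ^ k <= 4 ^ m) by (apply Nat.pow_le_mono_r; lia).
    apply le_INR in Hle; rewrite (H4R k) in Hle; nra. }
  replace k with ((k - m) + m) in Himp by lia; set (j := k - m) in *.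
  pose proof (implementation_cost alg m j M sched Hx H7 HM Hm1 Himp) as Hcost.
  apply le_INR in Hcost; rewrite mult_INR, pow_INR in Hcost.
  replace (INR 7) with 7%R in Hcost by (rewrite INR_IZR_INZ; reflexivity).
  refine (Rle_trans _ _ _ _ Hcost); apply Rmult_le_compat_r; [lra|].
  assert (Hbase : (INR (2 ^ k) / r <= 2 ^ (j + 5))%R).
  { apply (Rmult_le_reg_r r); [exact Hr|].
    unfold Rdiv; rewrite Rmult_assoc, Rinv_l, Rmult_1_r by lra.
    replace k with (j + m) by (unfold j; lia).
    rewrite Nat.pow_add_r, mult_INR, pow_add.
    rewrite (pow_INR 2 j); change (INR 2) with 2%R.
    assert (0 < 2 ^ j)%R by (apply pow_lt; lra).
    assert (INR (2 ^ m) <= 32 * r)%R.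
    { rewrite (H4R m) in Hm2R; pose proof (Hpos m); nra. }
    simpl (2 ^ 5)%R; nra. }
  assert (Hlog : (0 <= log2_7)%R).
  { unfold log2_7; apply Rlt_le, Rdiv_lt_0_compat; rewrite <- ln_1; apply ln_increasing; lra. }
  assert (Hp : (Rpower (INR (2 ^ k) / r) log2_7 <= 7 ^ (j + 5))%R).
  { rewrite <- Rpower_log2_7; apply Rle_Rpower_l; [exact Hlog|]; split; [|exact Hbase].
    apply Rdiv_lt_0_compat; auto. }
  rewrite pow_add in Hp.
  assert (H75 : (0 < 7 ^ 5)%R) by (apply pow_lt; lra).
  apply (Rmult_le_reg_l (7 ^ 5)); [exact H75|].
  rewrite <- Rmult_assoc, Rinv_r, Rmult_1_l by lra; lra.
Qed.

Theorem mainTheorem1 :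
  comm_lower_bound strassen_cdag /\ comm_lower_bound winograd_cdag.
Proof.
  split.
  - exact (lower_bound_of_expansion strassen strassen_expands strassen_seven_calls).
  - exact (lower_bound_of_expansion winograd winograd_expands winograd_seven_calls).
Qed.
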